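(* Let $f:\mathbb{R}_+\to\mathbb{R}$ be a convex nonincreasing function such that the equation $f(\tau)=0$ has a solution, and let $\tau_*$ denote the minimal root of $f(\tau)=0$. Let $\epsilon>0$, let $\alpha\in(1,2)$, let $0\le\tau_0<\tau_1$ satisfy $f(\tau_0)\ge f(\tau_1)>0$, and let $\mathcal{O}_f$ be an inexact evaluation oracle for $f$. Then the inexact secant method (defined in the context) applied to these data terminates after at most $$\max\left\{\,2+\log_{2/\alpha}\left(2C/\epsilon\right),\ 3\,\right\}$$ iterations, where $C:=\max\{\,|s_1|(\tau_*-\tau_1),\ \ell_1\,\}$ and $s_1:=(u_0-\ell_1)/(\tau_0-\tau_1)$, with $(\ell_0,u_0)=\mathcal{O}_f(\tau_0,\alpha)$ and $\ell_1$ the lower bound returned by $\mathcal{O}_f(\tau_1,\alpha)$.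
   Context: Write $[f>0]:=\{\tau\in\mathbb{R}_+ : f(\tau)>0\}$. Inexact evaluation oracle: for a function $f:\mathbb{R}_+\to\mathbb{R}$, an inexact evaluation oracle is a map $\mathcal{O}_f$ that assigns to each pair $(\tau,\alpha)\in[f>0]\times[1,\infty)$ real numbers $(\ell,u)$ such that $0<\ell\le f(\tau)\le u$ and $u/\ell\le\alpha$. Inexact secant method, with input $f$ (accessed via $\mathcal{O}_f$), $\epsilon>0$, $\alpha\in(1,2)$ and $\tau_0<\tau_1$: set $(\ell_0,u_0):=\mathcal{O}_f(\tau_0,\alpha)$. Then for $k=1,2,\dots$ perform the following iteration: (0) if $f(\tau_k)=0$, terminate and return $\tau_k$; (1) obtain $(\ell_k,u_k):=\mathcal{O}_f(\tau_k,\alpha)$; (2) replace $u_k$ by $\min\{u_k,u_{k-1}\}$; (3) if $u_k\le\epsilon$, terminate and return $\tau_k$; (4) otherwise set $s_k:=(u_{k-1}-\ell_k)/(\tau_{k-1}-\tau_k)$ and $\tau_{k+1}:=\tau_k-\ell_k/s_k$, and continue with $k+1$. The number of iterations is the number of indices $k\ge1$ for which this loop is entered. *)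

(* Defs.v *)
From mathcomp Require Import all_boot all_order all_algebra.
From mathcomp Require Import all_classical all_reals all_analysis.

Set Implicit Arguments.
Unset Strict Implicit.
Unset Printing Implicit Defensive.

Import Order.TTheory GRing.Theory Num.Theory.

Local Open Scope ring_scope.

(* A function on R_+ is represented by a total f : R -> R; nothing below uses
   its values on negative reals. *)

Definition is_minimal_root (R : realType) (f : R -> R) (tau : R) : Prop :=
  [/\ 0 <= tau, f tau = 0
    & forall t : R, 0 <= t -> f t = 0 -> tau <= t].

Definition logb (R : realType) (b x : R) : R := ln x / ln b.

(* O tau alpha is the pair (l, u); it is unconstrained when tau is outside
   [f > 0] or alpha < 1, where an oracle is not defined. *)
Definition inexact_oracle (R : realType) (f : R -> R)
    (O : R -> R -> R * R) : Prop :=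
  forall tau alpha : R, 0 <= tau -> 0 < f tau -> 1 <= alpha ->
    let: (l, u) := O tau alpha in
    [/\ 0 < l, l <= f tau, f tau <= u & u / l <= alpha].

(* [Running tau' u' tau]: the next iteration k is about to be entered, with
   tau' = tau_(k-1), u' = u_(k-1) and tau = tau_k.
   [Undefined]: the last iteration needed f or the oracle outside its domain,
   or a division by zero. *)
Inductive secant_state (R : realType) : Type :=
  | Running of R & R & R
  | Returned of R
  | Undefined.
Arguments Undefined {R}.

Definition is_running (R : realType) (st : secant_state R) : bool :=
  if st is Running _ _ _ then true else false.

Definition secant_iteration (R : realType) (f : R -> R) (O : R -> R -> R * R)
    (eps alpha tau' u' tau : R) : secant_state R :=
  if tau < 0 then Undefined
  else if f tau == 0 then Returned tau
  else if f tau < 0 then Undefined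
  else
    let: (l, u0) := O tau alpha in
    let u := Num.min u0 u' in
    if u <= eps then Returned tau
    else if tau' - tau == 0 then Undefined
    else
      let s := (u' - l) / (tau' - tau) in
      if s == 0 then Undefined
      else Running tau u (tau - l / s).

(* The state after the iterations k = 1, ..., n (or fewer, if one of them
   already stopped). *)
Fixpoint secant_method (R : realType) (f : R -> R) (O : R -> R -> R * R)
    (eps alpha tau0 tau1 : R) (n : nat) : secant_state R :=
  if n is m.+1 then
    match secant_method f O eps alpha tau0 tau1 m with
    | Running tau' u' tau => secant_iteration f O eps alpha tau' u' tau
    | st => st
    end
  else Running tau0 (O tau0 alpha).2 tau1.

(* Iterations 1, ..., N are entered, and iteration N returns a point. *)
Definition secant_terminates_after (R : realType) (f : R -> R)
    (O : R -> R -> R * R) (eps alpha tau0 tau1 : R) (N : nat) : Prop :=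
  (forall n : nat, (n < N)%N ->
     is_running (secant_method f O eps alpha tau0 tau1 n)) /\
  exists tau : R, secant_method f O eps alpha tau0 tau1 N = Returned tau.

(* Main.v *)
(* Write [S_k = |s_k|].  Convexity makes the secant through [(tau_(k-1), u_(k-1))]
   and [(tau_k, l_k)] reach zero no later than the minimal root [ts], so the
   iterates increase and stay below [ts]; in particular
   [l_k <= S_k * (ts - tau_1)].  The definition of the step gives
   [S_(k+1) / S_k + l_(k+1) / l_k = u_k / l_k <= alpha], so by AM-GM the product
   [S_k * l_k] shrinks by [(alpha / 2)^2] at each iteration.  Together,
   [l_k^2 <= (alpha / 2)^(2 (k - 1)) * C^2], and an iteration that does not stop
   has [eps < u_k <= alpha * l_k <= 2 * C * (alpha / 2)^k]. *)

Require Import Defs.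
From mathcomp Require Import all_boot all_order all_algebra.
From mathcomp Require Import all_classical all_reals all_analysis.
From mathcomp Require Import ring lra.

Set Implicit Arguments.
Unset Strict Implicit.
Unset Printing Implicit Defensive.

Import Order.TTheory GRing.Theory Num.Theory.

Local Open Scope classical_set_scope.
Local Open Scope ring_scope.

(** Convexity at the weight [(c - b) / (c - a)], cleared of its denominator so that [a = c] is
    allowed and later uses stay polynomial. *)
Lemma convex_chord (R : realType) (f : R -> R)
    (f_convex : convex_function (`[0, +oo[ : set R^o) (f : R^o -> R))
    (a b c : R) : 0 <= a -> a <= b -> b <= c ->
  (c - a) * f b <= (c - b) * f a + (b - a) * f c.
Proof.
move=> a0 ab bc; have [ac|] := ltP a c; last first.
  move=> ca; have -> : b = a by lra.
  have -> : c = a by lra.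
  lra.
have p0 : 0 <= (c - b) / (c - a) by rewrite divr_ge0 // subr_ge0 // ltW.
have p1 : (c - b) / (c - a) <= 1 by rewrite ler_pdivrMr ?subr_gt0 //; lra.
have ain : a \in (`[0, +oo[%classic : set R^o) by rewrite inE /= in_itv /= a0.
have cin : c \in (`[0, +oo[%classic : set R^o).
  by rewrite inE /= in_itv /= andbT (le_trans a0) // ltW.
set p := (c - b) / (c - a) in p0 p1 *.
have : f (p * a + (1 - p) * c) <= p * f a + (1 - p) * f c
  := f_convex (Itv01 p0 p1) a c ain cin.
rewrite /p.
have ca0 : c - a != 0 by rewrite subr_eq0 gt_eqF.
have -> : (c - b) / (c - a) * a + (1 - (c - b) / (c - a)) * c = b by field.
rewrite -(ler_pM2l (x := c - a)) ?subr_gt0 //.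
suff -> : (c - a) * ((c - b) / (c - a) * f a + (1 - (c - b) / (c - a)) * f c)
  = (c - b) * f a + (b - a) * f c by [].
by field.
Qed.

Lemma nonincreasing_half_line (R : realType) (f : R -> R)
    (f_nonincreasing : {in `[0, +oo[ &, nonincreasing_fun f}) (s t : R) :
  0 <= s -> s <= t -> f t <= f s.
Proof.
move=> s0 st; apply: f_nonincreasing => //; rewrite in_itv /= andbT //.
exact: le_trans s0 st.
Qed.

(** The infimum of the roots is itself a root: convexity replaces continuity, since a positive value
    there would lie above the chord from [a] to a root close enough on the right. *)
Lemma minimal_root_exists (R : realType) (f : R -> R) (a b : R)
    (f_convex : convex_function (`[0, +oo[ : set R^o) (f : R^o -> R))
    (f_nonincreasing : {in `[0, +oo[ &, nonincreasing_fun f})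
    (f_root : exists tau : R, 0 <= tau /\ f tau = 0) :
  0 <= a -> a < b -> 0 < f b -> exists ts : R, is_minimal_root f ts.
Proof.
move=> a0 ab fb0.
have f_mono := nonincreasing_half_line f_nonincreasing.
have fa0 : 0 < f a by apply: lt_le_trans fb0 _; apply: f_mono => //; exact: ltW.
pose Z := [set t : R | 0 <= t /\ f t = 0].
have Zn : Z !=set0 by [].
have lbZ : lbound Z b.
  move=> t [t0 ft0]; rewrite leNgt; apply/negP => tb.
  by have := f_mono _ _ t0 (ltW tb); lra.
have hlb : has_lbound Z by exists b.
have hinf : has_inf Z by [].
have bT : b <= inf Z by apply: lb_le_inf.
have infZ0 : f (inf Z) = 0; last first.
  exists (inf Z); split => //; first lra.
  by move=> t t0 ft0; apply: ge_inf.
apply: le_anti; apply/andP; split; last first.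
  have [t Zt] := Zn; rewrite -Zt.2; apply: f_mono; first lra.
  exact: ge_inf.
rewrite leNgt; apply/negP => fT0.
(* With [T = inf Z], a root [t] within this distance of [T] has [(t - T) * f a < (T - a) * f T],
   while the chord gives [(t - a) * f T <= (t - T) * f a]; this contradicts [T <= t]. *)
have e0 : 0 < (inf Z - a) * f (inf Z) / f a.
  by rewrite divr_gt0 // mulr_gt0 //; lra.
have [t Zt tlt] := inf_adherent e0 hinf.
have Tt : inf Z <= t by apply: ge_inf.
have := convex_chord f_convex a0 (le_trans (ltW ab) bT) Tt.
rewrite (proj2 Zt).
move: tlt; rewrite -ltrBlDl ltr_pdivlMr // => tlt; nra.
Qed.

(** The loop invariant on entering an iteration. The bound by [ts] is not strict: a secant may hit
    the root exactly, and the iteration then returns. *)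
Definition secant_ready (R : realType) (f : R -> R) (ts tau' u' tau : R) :=
  [/\ 0 <= tau', tau' < tau, tau <= ts & f tau' <= u'].

(** Rules out [Undefined] and carries the invariant to the next iterate. The slope is negative, so
    [S] is its absolute value and the step reads [tau + l / S]. *)
Lemma secant_iteration_step (R : realType) (f : R -> R) (O : R -> R -> R * R)
    (eps alpha ts tau' u' tau : R)
    (f_convex : convex_function (`[0, +oo[ : set R^o) (f : R^o -> R))
    (f_nonincreasing : {in `[0, +oo[ &, nonincreasing_fun f})
    (O_oracle : inexact_oracle f O) :
  1 <= alpha -> is_minimal_root f ts -> secant_ready f ts tau' u' tau ->
  let l := (O tau alpha).1 in
  let S := (u' - l) / (tau - tau') in
  (exists t, secant_iteration f O eps alpha tau' u' tau = Returned t) \/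
  (exists u, [/\ secant_iteration f O eps alpha tau' u' tau
                   = Running tau u (tau + l / S),
                 secant_ready f ts tau u (tau + l / S)
               & [/\ 0 < S, 0 < l, eps < u & u <= alpha * l]]).
Proof.
move=> alpha1 [ts0 fts0 ts_min] [tau'0 tau'tau tauts ftau'].
have f_mono := nonincreasing_half_line f_nonincreasing.
have tau0 : 0 <= tau by lra.
have ftau0 : 0 <= f tau by rewrite -fts0 f_mono.
rewrite /secant_iteration ltNge tau0 /=.
have [fz|fnz] := eqVneq (f tau) 0; first by left; exists tau.
have fpos : 0 < f tau by rewrite lt_neqAle eq_sym fnz.
rewrite ltNge ftau0 /=.
have := O_oracle tau alpha tau0 fpos alpha1.
case: (O tau alpha) => l u0 /= [l0 lf fu0 ul].
have [ue|eu] := leP (Num.min u0 u') eps; first by left; exists tau.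
right; exists (Num.min u0 u').
have chord := convex_chord f_convex tau'0 (ltW tau'tau) tauts.
have tau_lt_ts : tau < ts.
  by rewrite lt_neqAle tauts andbT; apply/eqP => tauE; rewrite tauE fts0 eqxx in fnz.
(* As [tau < ts], the chord down to the root makes [f] drop strictly from [tau'] to [tau], so the
   secant slope is nonzero. *)
have lu' : l < u' by rewrite fts0 in chord; nra.
have S0 : 0 < (u' - l) / (tau - tau') by rewrite divr_gt0 // subr_gt0.
have dn0 : tau' - tau != 0 by rewrite lt_eqF // subr_lt0.
have dn1 : tau - tau' != 0 by rewrite gt_eqF // subr_gt0.
have un0 : u' - l != 0 by rewrite gt_eqF // subr_gt0.
have sE : (u' - l) / (tau' - tau) = - ((u' - l) / (tau - tau')).
  by field; rewrite dn0 dn1.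
rewrite (negbTE dn0) sE oppr_eq0 (gt_eqF S0) invrN mulrN opprK; split => //.
  split => //; first by rewrite ltrDl divr_gt0.
    (* No overshoot of [ts]: this amounts to [l * (ts - tau') <= (ts - tau) * u'], the chord
       inequality with [f tau] lowered to [l] and [f tau'] raised to [u']. *)
    rewrite -lerBrDl ler_pdivrMr // mulrA ler_pdivlMr ?subr_gt0 //.
    by rewrite fts0 in chord; nra.
  rewrite le_min fu0 /=; apply: le_trans ftau'; apply: f_mono => //; exact: ltW.
split => //; rewrite ge_min; apply/orP; left.
by rewrite -ler_pdivrMr.
Qed.

(** Here [l] and [S] belong to iteration [n.+1], the last one performed, so the product bound starts
    as an equality at [n = 0]. *)
Lemma secant_method_invariant (R : realType) (f : R -> R)
    (O : R -> R -> R * R) (eps alpha tau0 tau1 ts : R)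
    (f_convex : convex_function (`[0, +oo[ : set R^o) (f : R^o -> R))
    (f_nonincreasing : {in `[0, +oo[ &, nonincreasing_fun f})
    (O_oracle : inexact_oracle f O) :
  0 < eps -> 1 <= alpha -> is_minimal_root f ts ->
  secant_ready f ts tau0 (O tau0 alpha).2 tau1 ->
  let l1 := (O tau1 alpha).1 in
  let S1 := ((O tau0 alpha).2 - l1) / (tau1 - tau0) in
  forall n,
  (exists t, secant_method f O eps alpha tau0 tau1 n.+1 = Returned t) \/
  (exists tau' u' l S,
    [/\ secant_method f O eps alpha tau0 tau1 n.+1
          = Running tau' u' (tau' + l / S),
        secant_ready f ts tau' u' (tau' + l / S),
        tau1 <= tau',
        [/\ 0 < S, 0 < l, eps < u' & u' <= alpha * l]
      & S * l <= (alpha / 2) ^+ (2 * n) * (S1 * l1)]).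
Proof.
move=> eps0 alpha1 tsP ready l1 S1.
have step := secant_iteration_step eps f_convex f_nonincreasing
  O_oracle alpha1 tsP.
elim=> [|n [[t IH]|]].
- have [ret|[u [eqn ready' bounds]]] := step _ _ _ ready; first by left.
  right; exists tau1, u, l1, S1; split => //.
  by rewrite muln0 expr0 mul1r.
- by left; exists t; rewrite /= in IH *; rewrite IH.
move=> [tau' [u' [l [S [run ready' tau1_le [S0 l0 epsu u_le] prod]]]]].
have [[t ret]|[u [eqn ready2 [S20 l20 epsu2 u2_le]]]] := step _ _ _ ready'.
  by left; exists t; rewrite -ret /= in run *; rewrite run.
set tau := tau' + l / S in run ready' eqn ready2 S20 l20 u2_le *.
set l2 := (O tau alpha).1 in eqn ready2 S20 l20 u2_le *.
set S2 := (u' - l2) / (tau - tau') in eqn ready2 S20 *.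
right; exists tau, u, l2, S2; split => //.
- by rewrite -eqn /= in run *; rewrite run.
- by case: ready' => _ /ltW tt _ _; exact: le_trans tau1_le tt.
(* The ratio identity [S2 / S + l2 / l = u' / l] without quotients; it holds because the last step
   had length [l / S]. *)
have S2E : S2 * l = (u' - l2) * S.
  rewrite /S2 (_ : tau - tau' = l / S); last by rewrite /tau addrAC subrr add0r.
  by field; rewrite !gt_eqF.
have amgm : S2 * l2 <= (alpha / 2) ^+ 2 * (S * l).
  rewrite -(ler_pM2r l0) mulrAC S2E.
  have u'0 : 0 < u' by lra.
  have sq_le : (u' - l2) * l2 <= (alpha * l) ^+ 2 / 4.
    have := sqr_ge0 (u' - 2 * l2).
    have : u' ^+ 2 <= (alpha * l) ^+ 2 by rewrite ler_pXn2r ?nnegrE //; lra.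
    by rewrite !expr2; nra.
  have -> : (alpha / 2) ^+ 2 * (S * l) * l = (alpha * l) ^+ 2 / 4 * S by field.
  by rewrite mulrAC ler_pM2r.
apply: le_trans amgm _.
rewrite mulnS exprD -mulrA ler_pM2l // exprn_gt0 //; lra.
Qed.

Lemma secant_running_bound (R : realType) (f : R -> R)
    (O : R -> R -> R * R) (eps alpha tau0 tau1 ts : R)
    (f_convex : convex_function (`[0, +oo[ : set R^o) (f : R^o -> R))
    (f_nonincreasing : {in `[0, +oo[ &, nonincreasing_fun f})
    (O_oracle : inexact_oracle f O) :
  0 < eps -> 1 < alpha -> alpha < 2 -> is_minimal_root f ts ->
  secant_ready f ts tau0 (O tau0 alpha).2 tau1 ->
  let l1 := (O tau1 alpha).1 in
  0 < l1 ->
  let s1 := ((O tau0 alpha).2 - l1) / (tau0 - tau1) in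
  let C := Num.max (`|s1| * (ts - tau1)) l1 in
  forall n, is_running (secant_method f O eps alpha tau0 tau1 n.+1) ->
  n.+1%:R < logb (2 / alpha) (2 * C / eps).
Proof.
move=> eps0 alpha1 alpha2 tsP ready l1 l1_gt0 s1 C n running.
have [[t ret]|] := secant_method_invariant f_convex f_nonincreasing O_oracle
  eps0 (ltW alpha1) tsP ready n; first by rewrite ret in running.
move=> [tau' [u' [l [S [_ [_ _ tau_ts _] tau1_le [S0 l0 epsu u_le]]]]]].
rewrite -/l1 -/s1.
set S1 := (_ / (tau1 - tau0)) => prod.
have alpha0 : 0 < alpha by lra.
have [_ tau01 tau1ts _] := ready.
have S1_le : S1 <= `|s1|.
  have -> : S1 = - s1; last by rewrite -normrN ler_norm.
  by rewrite /S1 /s1; field; rewrite !subr_eq0 lt_eqF // gt_eqF.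
set q := (alpha / 2) ^+ n.
have q0 : 0 < q by rewrite exprn_gt0 //; lra.
rewrite mulnC exprM -/q in prod.
have prod1_gt0 : 0 < S1 * l1.
  by rewrite -(pmulr_rgt0 _ (exprn_gt0 2 q0)); apply: lt_le_trans prod; exact: mulr_gt0.
(* The step of length [l / S] starts at or after [tau1] and ends at or before [ts]. *)
have l_le : l <= S * (ts - tau1).
  by rewrite mulrC -ler_pdivrMr //; lra.
have d0 : 0 < ts - tau1 by rewrite -(pmulr_rgt0 _ S0); exact: lt_le_trans l_le.
have lsq : l ^+ 2 <= q ^+ 2 * (S1 * (ts - tau1) * l1).
  have : S * l * (ts - tau1) <= q ^+ 2 * (S1 * l1) * (ts - tau1) by rewrite ler_pM2r.
  have : l * l <= S * (ts - tau1) * l by rewrite ler_pM2r.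
  rewrite expr2; lra.
have C0 : 0 <= C by rewrite le_max mulr_ge0 // ltW.
(* The two entries of the maximum [C] bound the two factors of [S1 * (ts - tau1) * l1], whence
   [C ^+ 2] and, after a square root, [C]. *)
have SC : S1 * (ts - tau1) <= C.
  by rewrite le_max; apply/orP; left; rewrite ler_pM2r.
have lC : l1 <= C by rewrite le_max lexx orbT.
have lqC : l <= q * C.
  suff : l ^+ 2 <= (q * C) ^+ 2.
    by rewrite ler_pXn2r // nnegrE ?mulr_ge0 // ltW.
  apply: le_trans lsq _; rewrite exprMn (ler_pM2l (exprn_gt0 2 q0)).
  have S10 : 0 < S1 by rewrite -(pmulr_lgt0 _ l1_gt0).
  by rewrite expr2; apply: ler_pM SC lC; rewrite ltW // mulr_gt0.
(* The oracle ratio [alpha], written [2 * (alpha / 2)], yields both the factor 2 and the extra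
   power. *)
have key : eps < 2 * C * (alpha / 2) ^+ n.+1.
  apply: lt_le_trans epsu _; apply: le_trans u_le _.
  have -> : 2 * C * (alpha / 2) ^+ n.+1 = alpha * (q * C).
    by rewrite exprS -/q; field.
  by rewrite ler_pM2l.
have lnb : 0 < ln (2 / alpha) by rewrite ln_gt0 // ltr_pdivlMr // mul1r.
have b0 : 0 < 2 / alpha by rewrite divr_gt0.
have qn0 : 0 < (alpha / 2) ^+ n.+1 by rewrite exprn_gt0 // divr_gt0.
have pw : (2 / alpha) ^+ n.+1 < 2 * C / eps.
  rewrite ltr_pdivlMr // -(ltr_pM2r qn0) mulrAC -exprMn.
  rewrite (_ : 2 / alpha * (alpha / 2) = 1) ?expr1n ?mul1r //.
  by field; rewrite gt_eqF.
rewrite /logb ltr_pdivlMr // [_ * ln _]mulr_natl -lnXn // ltr_ln ?posrE //.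
  exact: exprn_gt0.
by apply: lt_trans pw; exact: exprn_gt0.
Qed.

Theorem theorem2p2 (R : realType) (f : R -> R) (O : R -> R -> R * R)
    (eps alpha tau0 tau1 : R)
    (f_convex : convex_function (`[0, +oo[ : set R^o) (f : R^o -> R))
    (f_nonincreasing : {in `[0, +oo[ &, nonincreasing_fun f})
    (f_root : exists tau : R, 0 <= tau /\ f tau = 0)
    (eps_gt0 : 0 < eps)
    (alpha_gt1 : 1 < alpha) (alpha_lt2 : alpha < 2)
    (tau0_ge0 : 0 <= tau0) (tau0_lt_tau1 : tau0 < tau1)
    (f_tau01 : f tau1 <= f tau0) (f_tau1_gt0 : 0 < f tau1)
    (O_oracle : inexact_oracle f O) :
  exists tau_star : R, is_minimal_root f tau_star /\
    let u0 := (O tau0 alpha).2 in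
    let l1 := (O tau1 alpha).1 in
    let s1 := (u0 - l1) / (tau0 - tau1) in
    let C := Num.max (`|s1| * (tau_star - tau1)) l1 in
    exists N : nat,
      secant_terminates_after f O eps alpha tau0 tau1 N /\
      N%:R <= Num.max (2 + logb (2 / alpha) (2 * C / eps)) 3.
Proof.
have [ts tsP] := minimal_root_exists f_convex f_nonincreasing f_root tau0_ge0
  tau0_lt_tau1 f_tau1_gt0.
exists ts; split => // u0 l1 s1 C.
have ready : secant_ready f ts tau0 u0 tau1.
  case: tsP => ts0 fts0 _; split => //.
    rewrite leNgt; apply/negP => /ltW ts_lt.
    by have := nonincreasing_half_line f_nonincreasing ts0 ts_lt; lra.
  have := O_oracle tau0 alpha tau0_ge0 (lt_le_trans f_tau1_gt0 f_tau01) (ltW alpha_gt1).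
  by rewrite /u0; case: (O tau0 alpha) => l u [].
have l1_gt0 : 0 < l1.
  have := O_oracle tau1 alpha (ltW (le_lt_trans tau0_ge0 tau0_lt_tau1))
    f_tau1_gt0 (ltW alpha_gt1).
  by rewrite /l1; case: (O tau1 alpha) => l u [].
set L := logb _ _.
have run_bound n :
    is_running (secant_method f O eps alpha tau0 tau1 n.+1) -> n.+1%:R < L.
  exact: (secant_running_bound f_convex f_nonincreasing O_oracle).
have inv := secant_method_invariant f_convex f_nonincreasing O_oracle
  eps_gt0 (ltW alpha_gt1) tsP ready.
set stopped := fun n => ~~ is_running (secant_method f O eps alpha tau0 tau1 n).
have ex_stop : exists n, stopped n.
  (* Still running after this many iterations would put an integer exceeding the absolute value of
     [L] below [L]. *)
  exists (Num.truncn `|L|).+1; apply/negP => /run_bound.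
  apply/negP; rewrite -leNgt; apply: le_trans (ler_norm _) _.
  by apply/ltW; exact: truncnS_gt.
case: (ex_minnP ex_stop) => -[//|m] stop_m min_m.
exists m.+1; split; last first.
  (* Stopping at iteration 1 is covered by the constant 3. Otherwise the method still ran one
     iteration earlier, so that count is below [L]. *)
  rewrite le_max; case: m stop_m min_m => [_ _|m _ min_m].
    by apply/orP; right; lra.
  apply/orP; left.
  have running : is_running (secant_method f O eps alpha tau0 tau1 m.+1).
    by apply/negPn/negP => /min_m; rewrite ltnn.
  have := run_bound _ running.
  rewrite -[m.+2%:R]natr1; lra.
split.
  by move=> n nm; apply/negPn/negP => /min_m; rewrite leqNgt nm.
(* The invariant leaves only [Returned] or [Running], so a stopped method has returned a point. *)
have [//|[tau' [u' [l [S [run _ _ _ _]]]]]] := inv m.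
by rewrite /stopped run in stop_m.
Qed.
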